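(* Let $A$ be a unital Banach algebra and let $a\in A$ be such that $a^{\dag}$ exists. Then the following statements are equivalent: (i) $a$ is EP; (ii) there exist $b_1,c_1,d_1,f_1,g_1\in A$ such that $a=b_1c_1g_1$, $a^{\dag}=f_1d_1g_1$, $(c_1)^{-1}(0)=(d_1)^{-1}(0)$, and $(b_1)^{-1}(0)=(f_1)^{-1}(0)=0$; (iii) there exist $h_1,k_1,l_1,m_1,n_1\in A$ such that $a=h_1k_1l_1$, $a^{\dag}=h_1m_1n_1$, $l_1A=A=n_1A$, and $k_1A=m_1A$; (iv) there exist $b_2,c_2,d_2,g_2,g_3\in A$ such that $a=b_2c_2g_2$, $a^{\dag}=b_2d_2g_3$, $(c_2)_{-1}(0)=(d_2)_{-1}(0)$, and $(g_2)_{-1}(0)=(g_3)_{-1}(0)=0$; (v) there exist $h_2,h_3,k_2,l_2,m_2\in A$ such that $a=h_2k_2l_2$, $a^{\dag}=h_3m_2l_2$, $Ak_2=Am_2$, and $Ah_2=Ah_3=A$.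
   Context: $A$ is a complex unital Banach algebra. For $x\in A$: $x^{-1}(0)=\{y\in A: xy=0\}$, $x_{-1}(0)=\{y\in A: yx=0\}$, $xA=\{xy:y\in A\}$, $Ax=\{yx:y\in A\}$. An element $h\in A$ is hermitian if $\|\exp(ith)\|=1$ for all $t\in\mathbb{R}$. The Moore-Penrose inverse of $a\in A$, if it exists, is the (unique) $x\in A$ with $a=axa$, $x=xax$ and $ax$, $xa$ hermitian; it is denoted $a^{\dag}$. An element $a$ is EP if $a^{\dag}$ exists and $aa^{\dag}=a^{\dag}a$. *)

(* Defs.v *)
From HB Require Import structures.
From mathcomp Require Import all_boot all_order all_algebra.
From mathcomp Require Import all_classical all_reals all_analysis.
From mathcomp Require Import complex.

Set Implicit Arguments.
Unset Strict Implicit.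
Unset Printing Implicit Defensive.

Import Order.TTheory GRing.Theory Num.Theory.
Import numFieldNormedType.Exports.

Local Open Scope classical_set_scope.
Local Open Scope ring_scope.
Local Open Scope complex_scope.

(* A joint HB structure of normed modules and algebras is rejected by HB: the
   missing join of [GRing.PzSemiRing] and [Num.SemiNormedZmodule] would have to
   be declared before [Num.NumDomain]. So a unital Banach algebra is a record
   extending a Banach space with a product, and its carrier is then endowed with
   the canonical [algType] structure over that space. *)
Record banachAlgType (K : numFieldType) := BanachAlgType {
  banach_space : completeNormedModType K;
  banach_one : banach_space;
  banach_mul : banach_space -> banach_space -> banach_space;
  banach_mulA : associative banach_mul;
  banach_mul1r : left_id banach_one banach_mul;
  banach_mulr1 : right_id banach_one banach_mul;
  banach_mulDl : left_distributive banach_mul +%R;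
  banach_mulDr : right_distributive banach_mul +%R;
  banach_scaleAl : forall (k : K) (x y : banach_space),
    k *: banach_mul x y = banach_mul (k *: x) y;
  banach_scaleAr : forall (k : K) (x y : banach_space),
    k *: banach_mul x y = banach_mul x (k *: y);
  banach_norm1 : `|banach_one| = 1;
  banach_normM : forall x y : banach_space,
    `|banach_mul x y| <= `|x| * `|y|
}.

Definition banach_sort (K : numFieldType) (A : banachAlgType K) : Type :=
  banach_space A.
Coercion banach_sort : banachAlgType >-> Sortclass.

Section BanachAlgebraInstances.
Variables (K : numFieldType) (A : banachAlgType K).

HB.instance Definition _ :=
  CompleteNormedModule.copy (banach_sort A) (banach_space A).

Let one_neq0 : banach_one A != 0 :> banach_sort A.
Proof. by rewrite -normr_eq0 banach_norm1 oner_neq0. Qed.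

HB.instance Definition _ := GRing.Zmodule_isNzRing.Build (banach_sort A)
  (@banach_mulA K A) (@banach_mul1r K A) (@banach_mulr1 K A)
  (@banach_mulDl K A) (@banach_mulDr K A) one_neq0.

HB.instance Definition _ :=
  GRing.Lmodule_isLalgebra.Build K (banach_sort A) (@banach_scaleAl K A).

HB.instance Definition _ :=
  GRing.Lalgebra_isAlgebra.Build K (banach_sort A) (@banach_scaleAr K A).

End BanachAlgebraInstances.

(* [rannul x] is x^{-1}(0) and [lannul x] is x_{-1}(0). *)
Definition rannul (A : pzRingType) (x : A) : set A := [set y | x * y = 0].
Definition lannul (A : pzRingType) (x : A) : set A := [set y | y * x = 0].

(* [rprincipal x] is x A and [lprincipal x] is A x. *)
Definition rprincipal (A : pzRingType) (x : A) : set A := range (fun y => x * y).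
Definition lprincipal (A : pzRingType) (x : A) : set A := range (fun y => y * x).

Section MoorePenrose.
Variables (R : realType) (A : banachAlgType R[i]).
Implicit Types a x h : A.

Definition bexp x : A :=
  limn (series (fun n : nat => (n`!%:R : R[i])^-1 *: x ^+ n)).

Definition hermitian_elt h := forall t : R, `|bexp (('i * t%:C) *: h)| = 1.

Definition is_mpinv a x :=
  [/\ a = a * x * a, x = x * a * x, hermitian_elt (a * x) & hermitian_elt (x * a)].

Definition mp_invertible a := exists x, is_mpinv a x.

(* There is at most one [x] with [is_mpinv a x]; the value is 0 if there is none. *)
Definition mpinv a : A := xget 0 [set x | is_mpinv a x].

Definition EP a := mp_invertible a /\ a * mpinv a = mpinv a * a.

End MoorePenrose.

(* Main.v *)
(* Each of (ii)-(v) forces a and x = a^dag to have the same right annihilator,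
   right ideal, left annihilator or left ideal, and for a EP these equalities
   hold, so that the factorizations 1 * a * 1 and 1 * x * 1 do. Conversely, an
   equality of this kind says that the idempotents p = ax and q = xa have the
   same kernel or the same range, hence (p - q)^2 = 0. Since
   |exp(ith) - 1 - ith| <= |th|^2 for small t, a hermitian h has
   |1 + ith| <= 1 + O(t^2), a bound stable under real linear combinations; so
   p - q behaves as a hermitian nilpotent element, which has to vanish. *)

Require Import Defs.
From mathcomp Require Import all_boot all_order all_algebra.
From mathcomp Require Import all_classical all_reals all_analysis.
From mathcomp Require Import complex.
From mathcomp Require Import ring.

Import Order.TTheory GRing.Theory Num.Theory.
Import numFieldNormedType.Exports.

Local Open Scope classical_set_scope.
Local Open Scope ring_scope.
Local Open Scope complex_scope.

(** * Archimedean and elementary power estimates *)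

(** A nonnegative element of [R[i]] is real, so the Archimedean property of [R] applies to its real
    part. *)
Lemma complex_archi (R : realType) (x : R[i]) :
  0 <= x -> exists n, x < n%:R.
Proof.
move=> x0; exists (Num.bound (complex.Re x)).
rewrite -(RRe_real (ger0_real x0)) -(rmorph_nat (real_complex R)) ltcR.
by apply: archi_boundP; move: x0; rewrite lecE => /andP[].
Qed.

Lemma archi_mulr_bounded_eq0 (R : realType) (x c : R[i]) :
  0 <= x -> (forall k, k%:R * x <= c) -> x = 0.
Proof.
move=> x0 xc; apply/eqP/negPn/negP => xN0.
have {xN0} xgt0 : 0 < x by rewrite lt0r xN0.
have c0 : 0 <= c by apply: le_trans (xc 0%N); rewrite mul0r.
have [n] := @complex_archi R (c / x) (divr_ge0 c0 x0).
by rewrite ltr_pdivrMr// => /lt_le_trans /(_ (xc n)); rewrite ltxx.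
Qed.

Lemma banach_normX (K : numFieldType) (A : banachAlgType K) (x : A) n :
  `|x ^+ n| <= `|x| ^+ n.
Proof.
elim: n => [|n IH]; first by rewrite !expr0 (banach_norm1 A).
rewrite !exprS; apply: le_trans (banach_normM x (x ^+ n)) _.
by rewrite ler_wpM2l.
Qed.

Lemma bernoulli_sub (K : numFieldType) (c : K) n :
  0 <= c -> c <= 1 -> 1 - n%:R * c <= (1 - c) ^+ n.
Proof.
move=> c0 c1; elim: n => [|n IH]; first by rewrite mul0r subr0 expr0.
rewrite exprSr; apply: (@le_trans _ _ ((1 - n%:R * c) * (1 - c))); last first.
  by rewrite ler_wpM2r// subr_ge0.
rewrite -subr_ge0 -natr1 (_ : _ - _ = n%:R * c ^+ 2); last by ring.
by rewrite mulr_ge0 // exprn_ge0.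
Qed.

(** Bernoulli gives [(1 - c) ^+ n >= 1/2], while [(1 + c) ^+ n * (1 - c) ^+ n = (1 - c ^+ 2) ^+ n]
    is at most 1. *)
Lemma expr1D_le2 (K : numFieldType) (c : K) n :
  0 <= c -> n%:R * c <= 2^-1 -> (1 + c) ^+ n <= 2.
Proof.
move=> c0 nc.
(* For [n = 0] the hypothesis gives no bound on [c]; otherwise it forces [c <= 1]. *)
case: n nc => [|n] nc; first by rewrite expr0 ler1n.
have h1 : (2^-1 : K) <= 1 by rewrite invf_le1 ?ler1n.
have c1 : c <= 1.
  apply: le_trans h1; apply: le_trans nc.
  by rewrite -{1}[c]mul1r ler_wpM2r// ler1n.
have c1' : 0 <= 1 - c by rewrite subr_ge0.
have c2 : 2^-1 <= (1 - c) ^+ n.+1.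
  apply: le_trans (bernoulli_sub K c n.+1 c0 c1).
  by rewrite lerBrDr -lerBrDl (_ : 1 - 2^-1 = 2^-1 :> K)//; field.
have c3 : (1 + c) ^+ n.+1 * (1 - c) ^+ n.+1 <= 1.
  rewrite -exprMn exprn_ile1//.
    by rewrite mulr_ge0// addr_ge0.
  by rewrite (_ : _ * _ = 1 - c ^+ 2); [rewrite gerBl exprn_ge0 | ring].
rewrite -(@ler_pM2r _ 2^-1) ?invr_gt0// mulfV ?pnatr_eq0//.
apply: le_trans c3; rewrite ler_wpM2l// exprn_ge0// addr_ge0//.
Qed.

(** * The exponential series near 0 *)

(** Since [k! >= k (k - 1)] and [|x| <= 1], the term of index [k >= 2] is at most
    [|x|^2 (1/(k-1) - 1/k)], and these bounds telescope. Large [n] gives convergence; [n = 2] gives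
    the quadratic remainder. *)
Lemma bexp_tail (R : realType) (A : banachAlgType R[i]) (x : A) n m :
  `|x| <= 1 -> (1 < n <= m)%N ->
  `|\sum_(n <= k < m) (k`!%:R : R[i])^-1 *: x ^+ k| <= `|x| ^+ 2 / n.-1%:R.
Proof.
move=> x1 /andP[n1 nm].
apply: (le_trans (ler_norm_sum _ _ _)).
apply: (@le_trans _ _ (\sum_(n <= k < m)
    `|x| ^+ 2 * ((- k.+1.-1%:R^-1) - (- k.-1%:R^-1)))).
  rewrite big_nat [leRHS]big_nat; apply: ler_sum => k /andP[nk _].
  have := leq_trans n1 nk; case: k {nk} => [|[|k]] // _.
  rewrite normrZ ger0_norm ?invr_ge0//.
  apply: (@le_trans _ _ (k.+2`!%:R^-1 * `|x| ^+ 2)).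
    rewrite ler_wpM2l ?invr_ge0//; apply: le_trans (banach_normX _ _ _ _) _.
    by rewrite -addn2 exprD ler_piMl ?exprn_ge0// exprn_ile1.
  rewrite mulrC ler_wpM2l ?exprn_ge0//=.
  rewrite (_ : - _ - - _ = (k.+2 * k.+1)%:R^-1); last first.
    by rewrite natrM -(natr1 k.+1) -natr1; field; rewrite !natr1 ?pnatr_eq0.
  rewrite lef_pV2 ?posrE ?ltr0n ?fact_gt0//.
  by rewrite ler_nat !factS mulnA leq_pmulr// fact_gt0.
rewrite -mulr_sumr telescope_sumr// ler_wpM2l ?exprn_ge0// opprK addrC.
by rewrite gerBl invr_ge0.
Qed.

Lemma is_cvg_bexp (R : realType) (A : banachAlgType R[i]) (x : A) :
  `|x| <= 1 -> cvgn (series (fun n : nat => (n`!%:R : R[i])^-1 *: x ^+ n)).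
Proof.
move=> x1; apply/cauchy_cvgP/cauchy_seriesP => e e0.
have eV0 : 0 <= e^-1 by rewrite invr_ge0 ltW.
have [N HN] := @complex_archi R e^-1 eV0.
(* The shift by two gives both [1 < n], required by the tail bound, and [N <= n.-1]. *)
exists ([set k | (N.+2 <= k)%N], setT) => /=.
  by split; [exact: nbhs_infty_ge | exact: filterT].
move=> [n m] /= [Nn _]; have [nm|mn] := leqP n m; last first.
  by rewrite big_geq 1?ltnW// normr0.
have n1 : (1 < n)%N by apply: leq_trans Nn.
apply: le_lt_trans (bexp_tail R A x n m x1 _) _; first by rewrite n1.
apply: (@le_lt_trans _ _ n.-1%:R^-1).
  by rewrite ler_piMl ?invr_ge0// exprn_ile1.
rewrite invf_plt ?posrE//; last by rewrite ltr0n -ltnS prednK// ltnW.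
by apply: lt_le_trans HN _; rewrite ler_nat -ltnS prednK// ltnW// ltnW.
Qed.

(** A partial sum [S] is compared with both sides: one [|x|^2] bounds its distance to the limit, the
    other its terms of index at least 2. *)
Lemma norm1D_bexp (R : realType) (A : banachAlgType R[i]) (x : A) :
  `|x| <= 1 -> `|1 + x| <= `|bexp x| + 2 * `|x| ^+ 2.
Proof.
move=> x1; have [->|xN0] := eqVneq x 0.
  have b0 : bexp (0 : A) = 1.
    apply: cvg_lim => //.
    (* The partial sum of index 0 is empty; all later ones equal 1. *)
    rewrite -(cvg_shiftS _); apply: cvg_near_cst; apply: nearW => n.
    rewrite /series /= big_nat_recl//= fact0 invr1 expr0 scale1r.
    by rewrite big1 ?addr0// => i _; rewrite expr0n scaler0.
  by rewrite b0 addr0 normr0 expr0n mulr0 addr0.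
(* The precision asked of the partial sum is [|x|^2], which must be positive; hence the separate
   case [x = 0]. *)
have e0 : 0 < `|x| ^+ 2 by rewrite exprn_gt0// normr_gt0.
have /cvgrPdist_le /(_ _ e0) [N _ HN] := is_cvg_bexp R A x x1.
(* With at least two terms, the partial sum contains [1 + x]. *)
have {HN} := HN (N + 2)%N (leq_addr _ _).
set S := series _ _ => HS.
have S2 : `|S - (1 + x)| <= `|x| ^+ 2.
  have -> : S - (1 + x) = \sum_(2 <= k < N + 2) (k`!%:R : R[i])^-1 *: x ^+ k.
    rewrite /S /series /= (@big_cat_nat _ _ _ 2)//= ?leq_addl//.
    rewrite big_nat_recr//= big_nat1 fact0 (_ : 1`! = 1)%N// invr1 expr0 expr1 !scale1r.
    by rewrite [LHS]addrAC subrr add0r.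
  apply: le_trans (bexp_tail R A x 2 (N + 2)%N x1 _) _; first by rewrite leq_addl.
  by rewrite divr1.
rewrite (_ : 1 + x = bexp x - (bexp x - S) - (S - (1 + x))); last first.
  by rewrite !subKr.
rewrite (_ : 2 * `|x| ^+ 2 = `|x| ^+ 2 + `|x| ^+ 2); last by rewrite mulr2n mulrDl mul1r.
rewrite addrA; apply: le_trans (ler_normB _ _) _; apply: lerD S2.
by apply: le_trans (ler_normB _ _) _; apply: lerD.
Qed.

(** * Hermitian elements whose difference has square zero *)

Lemma hermitian_norm1D (R : realType) (A : banachAlgType R[i]) (h : A) (t : R) :
  hermitian_elt h -> `|t%:C| * `|h| <= 1 ->
  `|1 + ('i * t%:C) *: h| <= 1 + 2 * (`|t%:C| * `|h|) ^+ 2.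
Proof.
move=> hh th; have nE : `|('i * t%:C) *: h| = `|t%:C| * `|h|.
  by rewrite normrZ normrM normCi mul1r.
by apply: le_trans (norm1D_bexp _ _ _ _) _; rewrite nE// hh.
Qed.

Lemma expr1D_sq0 (K : pzRingType) (x : K) n :
  x ^+ 2 = 0 -> (1 + x) ^+ n = 1 + x *+ n.
Proof.
move=> x2; elim: n => [|n IH]; first by rewrite mulr0n addr0.
rewrite exprS IH mulrDl mul1r mulrDr mulr1 mulrnAr -expr2 x2 mul0rn addr0.
by rewrite -addrA -mulrSr.
Qed.

(* [|1 + i t (u - v)| <= 1 + O(t^2)] for small real [t], while the n-th power of
   [1 + i t (u - v)] is [1 + i n t (u - v)]. With [t = 1 / (k d)] and [n = k^2]
   the powers have norm at most 2, so [(k / d) |u - v| <= 3] for all [k]. *)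
Lemma hermitian_sub_sq0 (R : realType) (A : banachAlgType R[i]) (u v : A) :
  hermitian_elt u -> hermitian_elt v -> (u - v) ^+ 2 = 0 -> u = v.
Proof.
move=> hu hv uv2; apply/eqP; rewrite -subr_eq0 -normr_eq0.
pose M := 1 + `|u| + `|v|.
have M1 : 1 <= M by rewrite /M -addrA lerDl addr_ge0.
have M0 : 0 <= M by apply: le_trans M1.
(* The factor 4 is set by the error below: [(k+1)^2 * c] equals [(4 M / d)^2 / 2], which is then at
   most [1/2]. *)
have [d dM] := @complex_archi R (4 * M) (mulr_ge0 (ler0n _ _) M0).
have d0 : (0 < d)%N by rewrite -(ltr0n R[i]); apply: le_lt_trans dM; rewrite mulr_ge0.
have dN0 : d%:R != 0 :> R[i] by rewrite pnatr_eq0 -lt0n.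
apply/eqP/(@archi_mulr_bounded_eq0 _ _ (3 * d%:R)) => // k.
case: k => [|k]; first by rewrite mul0r mulr_ge0.
have kN0 : k.+1%:R != 0 :> R[i] by rewrite pnatr_eq0.
pose t : R := (k.+1%:R * d%:R)^-1.
have tE : t%:C = (k.+1%:R * d%:R)^-1.
  by rewrite /t fmorphV rmorphM !rmorph_nat.
have t0 : 0 <= t%:C by rewrite tE invr_ge0 mulr_ge0.
(* The error of the hermitian bound at parameter [2 t]: below, [1 + z] is the mean of [1 + 2 i t u]
   and [1 - 2 i t v]. *)
pose c : R[i] := 2 * ((2 * t)%:C * M) ^+ 2.
have s0 : 0 <= (2 * t)%:C :> R[i] by rewrite rmorphM /= rmorph_nat mulr_ge0.
have sE : (2 * t)%:C = 2 * t%:C :> R[i] by rewrite rmorphM /= rmorph_nat.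
have sM : (2 * t)%:C * M <= 1 :> R[i].
  rewrite sE tE mulrAC ler_pdivrMr ?mul1r ?mulr_gt0 ?ltr0n//.
  apply: (@le_trans _ _ d%:R); last by rewrite ler_peMl ?ler1n.
  by apply: le_trans (ltW dM); rewrite ler_wpM2r// ler_nat.
have c0 : 0 <= c by rewrite mulr_ge0// exprn_ge0// mulr_ge0.
have hermc (w : A) (r : R) : hermitian_elt w -> `|w| <= M ->
    `|r%:C| = (2 * t)%:C :> R[i] -> `|1 + ('i * r%:C) *: w| <= 1 + c.
  move=> hw wM rE; have wM' : (2 * t)%:C * `|w| <= (2 * t)%:C * M :> R[i].
    by rewrite ler_wpM2l.
  apply: le_trans (hermitian_norm1D _ _ _ _ hw _) _; rewrite rE.
    exact: le_trans wM' sM.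
  by rewrite lerD2l ler_wpM2l// lerXn2r// nnegrE mulr_ge0.
pose z : A := ('i * t%:C) *: (u - v).
have zc : `|1 + z| <= 1 + c.
  have -> : 1 + z = 2^-1 *: ((1 + ('i * (2 * t)%:C) *: u) +
      (1 + ('i * (- (2 * t))%:C) *: v)).
    rewrite addrACA scalerDr -mulr2n -[(1 : A) *+ 2]scaler_nat scalerA.
    rewrite mulVf ?pnatr_eq0// scale1r.
    congr (1 + _); rewrite rmorphN /= mulrN scaleNr -scalerBr scalerA sE /z.
    by congr (_ *: _); field.
  rewrite normrZ ger0_norm ?invr_ge0// ler_pdivrMl ?ltr0n//.
  rewrite (_ : 2 * (1 + c) = (1 + c) + (1 + c)); last by ring.
  apply: le_trans (ler_normD _ _) _; apply: lerD; apply: hermc => //.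
  - by rewrite /M addrAC lerDr addr_ge0.
  - by rewrite ger0_norm.
  - by rewrite /M lerDr addr_ge0.
  - by rewrite rmorphN normrN ger0_norm.
have z2 : z ^+ 2 = 0 by rewrite exprZn uv2 scaler0.
have nc : (k.+1 ^ 2)%:R * c <= 2^-1.
  rewrite /c sE tE natrX (_ : _ * _ = 2^-1 * (4 * M / d%:R) ^+ 2); last first.
    by move: (k.+1%:R) (d%:R) kN0 dN0 => x y x0 y0; field; rewrite x0 y0.
  rewrite ler_piMr ?invr_ge0// exprn_ile1 ?divr_ge0 ?mulr_ge0//.
  by rewrite ler_pdivrMr ?ltr0n// mul1r ltW.
have := expr1D_le2 _ _ _ c0 nc.
have /le_trans zn : `|(1 + z) ^+ (k.+1 ^ 2)| <= (1 + c) ^+ (k.+1 ^ 2).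
  by apply: le_trans (banach_normX _ _ _ _) _; rewrite lerXn2r ?nnegrE ?addr_ge0.
move=> {}/zn; rewrite expr1D_sq0// => zn.
(* The bound 2 on the power, plus 1 for subtracting the unit. *)
have {zn} : `|z *+ (k.+1 ^ 2)| <= 3.
  rewrite -[z *+ _](addrK 1) addrC addrA.
  rewrite (natrD _ 1 2).
  rewrite -addrA; apply: le_trans (ler_normD _ _) _.
  by apply: lerD; [rewrite normrN (banach_norm1 A) | rewrite addrC].
rewrite -scaler_nat /z scalerA normrZ normrM normr_nat normrM normCi mul1r.
rewrite (ger0_norm t0) tE natrX (_ : _ / _ = k.+1%:R / d%:R); last first.
  by move: (k.+1%:R) (d%:R) kN0 dN0 => x y x0 y0; field; rewrite x0 y0.
by rewrite mulrAC ler_pdivrMr ?ltr0n.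
Qed.

(** * Idempotents, annihilators and principal ideals in a ring *)

(** For left multiplications, the first alternative means equal kernels and the second equal ranges.
    In both, [p * q + q * p = p + q]. *)
Lemma idempotent_sub_sq0 (K : pzRingType) (p q : K) :
    p * p = p -> q * q = q ->
    (p * q = p /\ q * p = q) \/ (p * q = q /\ q * p = p) ->
  (p - q) ^+ 2 = 0.
Proof.
move=> pp qq H; rewrite expr2 mulrBr !mulrBl pp qq.
by case: H => -[-> ->]; rewrite !subrr.
Qed.

Lemma commuting_inner_inverse (K : pzRingType) (a x : K) :
  a * x * a = a -> a * x = x * a -> a * a * x = a /\ x * (a * a) = a.
Proof. by move=> axa ax; rewrite -mulrA ax !mulrA -ax. Qed.

Lemma rannulMl (K : pzRingType) (b y : K) :
  rannul b = [set 0] -> rannul (b * y) = rannul y.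
Proof.
move=> b0; apply/seteqP; split=> z; rewrite /rannul /= -mulrA => h;
  last by rewrite h mulr0.
by have : [set 0] (y * z) by rewrite -b0.
Qed.

Lemma rannulMr (K : pzRingType) (c d g : K) :
  rannul c = rannul d -> rannul (c * g) = rannul (d * g).
Proof.
move=> cd; apply/seteqP; split=> z; rewrite /rannul /= -!mulrA => h.
  by have : rannul d (g * z) by rewrite -cd.
by have : rannul c (g * z) by rewrite cd.
Qed.

Lemma lannulMr (K : pzRingType) (b y : K) :
  lannul b = [set 0] -> lannul (y * b) = lannul y.
Proof.
move=> b0; apply/seteqP; split=> z; rewrite /lannul /= mulrA => h;
  last by rewrite h mul0r.
by have : [set 0] (z * y) by rewrite -b0.
Qed.

Lemma lannulMl (K : pzRingType) (c d g : K) :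
  lannul c = lannul d -> lannul (g * c) = lannul (g * d).
Proof.
move=> cd; apply/seteqP; split=> z; rewrite /lannul /= !mulrA => h.
  by have : lannul d (z * g) by rewrite -cd.
by have : lannul c (z * g) by rewrite cd.
Qed.

Lemma rprincipalMr (K : pzRingType) (k l : K) :
  rprincipal l = [set: K] -> rprincipal (k * l) = rprincipal k.
Proof.
move=> lT; apply/seteqP; split=> _ [y _ <-]; first by exists (l * y); rewrite ?mulrA.
have [z _ <-] : rprincipal l y by rewrite lT.
by exists z; rewrite ?mulrA.
Qed.

Lemma rprincipalMl (K : pzRingType) (h k m : K) :
  rprincipal k = rprincipal m -> rprincipal (h * k) = rprincipal (h * m).
Proof.
move=> km; apply/seteqP; split=> _ [y _ <-]; rewrite -mulrA.
  have [z _ <-] : rprincipal m (k * y) by rewrite -km; exists y.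
  by exists z; rewrite ?mulrA.
have [z _ <-] : rprincipal k (m * y) by rewrite km; exists y.
by exists z; rewrite ?mulrA.
Qed.

Lemma lprincipalMl (K : pzRingType) (k l : K) :
  lprincipal l = [set: K] -> lprincipal (l * k) = lprincipal k.
Proof.
move=> lT; apply/seteqP; split=> _ [y _ <-]; first by exists (y * l); rewrite ?mulrA.
have [z _ <-] : lprincipal l y by rewrite lT.
by exists z; rewrite ?mulrA.
Qed.

Lemma lprincipalMr (K : pzRingType) (h k m : K) :
  lprincipal k = lprincipal m -> lprincipal (k * h) = lprincipal (m * h).
Proof.
move=> km; apply/seteqP; split=> _ [y _ <-]; rewrite mulrA.
  have [z _ <-] : lprincipal m (y * k) by rewrite -km; exists y.
  by exists z; rewrite ?mulrA.
have [z _ <-] : lprincipal k (y * m) by rewrite km; exists y.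
by exists z; rewrite ?mulrA.
Qed.

Lemma rannul_sub (K : pzRingType) (w v : K) : rannul v `<=` rannul (w * v).
Proof. by move=> y; rewrite /rannul /= -mulrA => ->; rewrite mulr0. Qed.

Lemma lannul_sub (K : pzRingType) (w v : K) : lannul v `<=` lannul (v * w).
Proof. by move=> y; rewrite /lannul /= mulrA => ->; rewrite mul0r. Qed.

Lemma rprincipal_sub (K : pzRingType) (w v : K) : rprincipal (v * w) `<=` rprincipal v.
Proof. by move=> _ [y _ <-]; exists (w * y); rewrite ?mulrA. Qed.

Lemma lprincipal_sub (K : pzRingType) (w v : K) : lprincipal (w * v) `<=` lprincipal v.
Proof. by move=> _ [y _ <-]; exists (y * w); rewrite ?mulrA. Qed.

Lemma rannul1 (K : pzRingType) : rannul (1 : K) = [set 0].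
Proof. by apply/seteqP; split=> y; rewrite /rannul /= mul1r. Qed.

Lemma lannul1 (K : pzRingType) : lannul (1 : K) = [set 0].
Proof. by apply/seteqP; split=> y; rewrite /lannul /= mulr1. Qed.

Lemma rprincipal1 (K : pzRingType) : rprincipal (1 : K) = [set: K].
Proof. by apply/seteqP; split=> y // _; exists y; rewrite ?mul1r. Qed.

Lemma lprincipal1 (K : pzRingType) : lprincipal (1 : K) = [set: K].
Proof. by apply/seteqP; split=> y // _; exists y; rewrite ?mulr1. Qed.

(** * EP through equality of annihilators or of ideals *)

Section EPCriteria.
Variables (R : realType) (A : banachAlgType R[i]) (a : A).
Hypothesis ha : mp_invertible a.

Local Notation x := (mpinv a).

Lemma mpinvP : is_mpinv a x.
Proof. exact: xgetPex ha. Qed.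

(** With [p = a * x] and [q = x * a], the hypotheses give [p * q = p] and [q * p = q], the case of
    equal kernels; EP is [p = q]. *)
Lemma EP_left : x * x * a = x -> a * a * x = a -> EP a.
Proof.
move=> xxa aax; split=> //; have [axa xax hp hq] := mpinvP.
apply: hermitian_sub_sq0 => //; apply: idempotent_sub_sq0.
- by rewrite mulrA -axa.
- by rewrite mulrA -xax.
by left; rewrite -!mulrA (mulrA x x) xxa (mulrA a a) aax.
Qed.

(** Here [p * q = q] and [q * p = p], the case of equal ranges. *)
Lemma EP_right : a * x * x = x -> x * a * a = a -> EP a.
Proof.
move=> axx xaa; split=> //; have [axa xax hp hq] := mpinvP.
apply: hermitian_sub_sq0 => //; apply: idempotent_sub_sq0.
- by rewrite mulrA -axa.
- by rewrite mulrA -xax.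
by right; rewrite !mulrA axx xaa.
Qed.

(** Each of [a] and [x] becomes a left and a right multiple of the other, which yields the
    inclusions between their annihilators and ideals. *)
Lemma EP_mulE : a * x = x * a ->
  (a = a * a * x /\ a = x * (a * a)) /\ (x = x * x * a /\ x = a * (x * x)).
Proof.
have [axa xax _ _] := mpinvP => ax.
have [aL aR] := commuting_inner_inverse _ _ _ (esym axa) ax.
by have [xL xR] := commuting_inner_inverse _ _ _ (esym xax) (esym ax).
Qed.

(** [1 - x * a] is killed by [a] and [1 - a * x] by [x]; exchanging the annihilators gives the two
    identities of [EP_left]. *)
Lemma EP_rannul : rannul a = rannul x <-> EP a.
Proof.
have [axa xax _ _] := mpinvP; split=> [ax|[_ ax]].
  have hx : rannul x (1 - x * a).
    by rewrite -ax /rannul /= mulrBr mulr1 mulrA -axa subrr.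
  have ha' : rannul a (1 - a * x).
    by rewrite ax /rannul /= mulrBr mulr1 mulrA -xax subrr.
  apply: EP_left; apply/esym/eqP; rewrite -subr_eq0 -mulrA.
    by rewrite -{1}(mulr1 x) -mulrBr; apply/eqP.
  by rewrite -{1}(mulr1 a) -mulrBr; apply/eqP.
have [[aL aR] [xL xR]] := EP_mulE ax.
apply/seteqP; split.
  by rewrite [X in _ `<=` X](congr1 (@rannul _) xL); exact: rannul_sub.
by rewrite [X in _ `<=` X](congr1 (@rannul _) aL); exact: rannul_sub.
Qed.

Lemma EP_lannul : lannul a = lannul x <-> EP a.
Proof.
have [axa xax _ _] := mpinvP; split=> [ax|[_ ax]].
  have hx : lannul x (1 - a * x).
    by rewrite -ax /lannul /= mulrBl mul1r -axa subrr.
  have ha' : lannul a (1 - x * a).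
    by rewrite ax /lannul /= mulrBl mul1r -xax subrr.
  apply: EP_right; apply/esym/eqP; rewrite -subr_eq0.
    by rewrite -{1}(mul1r x) -mulrBl; apply/eqP.
  by rewrite -{1}(mul1r a) -mulrBl; apply/eqP.
have [[aL aR] [xL xR]] := EP_mulE ax.
apply/seteqP; split.
  by rewrite [X in _ `<=` X](congr1 (@lannul _) xR); exact: lannul_sub.
by rewrite [X in _ `<=` X](congr1 (@lannul _) aR); exact: lannul_sub.
Qed.

(** Writing [x = a * y] gives [a * x * x = a * x * a * y = x]; likewise [a = x * z] gives
    [x * a * a = a]. *)
Lemma EP_rprincipal : rprincipal a = rprincipal x <-> EP a.
Proof.
have [axa xax _ _] := mpinvP; split=> [ax|[_ ax]].
  have [y _ xE] : rprincipal a x by rewrite ax; exists 1; rewrite ?mulr1.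
  have [z _ aE] : rprincipal x a by rewrite -ax; exists 1; rewrite ?mulr1.
  apply: EP_right; first by rewrite -[X in _ * X = _]xE mulrA -axa.
  by rewrite -[X in _ * X = _]aE mulrA -xax.
have [[aL aR] [xL xR]] := EP_mulE ax.
apply/seteqP; split.
  by rewrite [X in X `<=` _](congr1 (@rprincipal _) aR); exact: rprincipal_sub.
by rewrite [X in X `<=` _](congr1 (@rprincipal _) xR); exact: rprincipal_sub.
Qed.

Lemma EP_lprincipal : lprincipal a = lprincipal x <-> EP a.
Proof.
have [axa xax _ _] := mpinvP; split=> [ax|[_ ax]].
  have [y _ xE] : lprincipal a x by rewrite ax; exists 1; rewrite ?mul1r.
  have [z _ aE] : lprincipal x a by rewrite -ax; exists 1; rewrite ?mul1r.
  apply: EP_left; first by rewrite -[X in X * _ * _ = _]xE -!mulrA (mulrA a) -axa.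
  by rewrite -[X in X * _ * _ = _]aE -!mulrA (mulrA x) -xax.
have [[aL aR] [xL xR]] := EP_mulE ax.
apply/seteqP; split.
  by rewrite [X in X `<=` _](congr1 (@lprincipal _) aL); exact: lprincipal_sub.
by rewrite [X in X `<=` _](congr1 (@lprincipal _) xL); exact: lprincipal_sub.
Qed.

End EPCriteria.

Theorem theorem5p6 (R : realType) (A : banachAlgType R[i]) (a : A)
    (ha : mp_invertible a) :
  [<->
    (* (i) *)
    EP a;
    (* (ii) *)
    exists b1 c1 d1 f1 g1 : A,
      [/\ a = b1 * c1 * g1, mpinv a = f1 * d1 * g1,
          rannul c1 = rannul d1,
          rannul b1 = [set 0] & rannul f1 = [set 0]];
    (* (iii) *)
    exists h1 k1 l1 m1 n1 : A,
      [/\ a = h1 * k1 * l1, mpinv a = h1 * m1 * n1,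
          rprincipal l1 = [set: A], rprincipal n1 = [set: A]
        & rprincipal k1 = rprincipal m1];
    (* (iv) *)
    exists b2 c2 d2 g2 g3 : A,
      [/\ a = b2 * c2 * g2, mpinv a = b2 * d2 * g3,
          lannul c2 = lannul d2,
          lannul g2 = [set 0] & lannul g3 = [set 0]];
    (* (v) *)
    exists h2 h3 k2 l2 m2 : A,
      [/\ a = h2 * k2 * l2, mpinv a = h3 * m2 * l2,
          lprincipal k2 = lprincipal m2,
          lprincipal h2 = [set: A] & lprincipal h3 = [set: A]]
  ].
Proof.
(* The arrows run in the cycle (i), (ii), (iii), (iv), (v), (i), each through [EP a]: outer factors
   that are injective or surjective are stripped, and the common factor preserves the remaining
   equality. *)
tfae.
- move=> /(EP_rannul R A a ha) ax; exists 1, a, (mpinv a), 1, 1.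
  by split; rewrite ?mul1r ?mulr1 ?rannul1.
- move=> [b [c [d [f [g [aE xE cd b0 f0]]]]]].
  have /(EP_rannul R A a ha) : rannul a = rannul (mpinv a).
    by rewrite xE aE -!mulrA (rannulMl _ b)// (rannulMl _ f)//; exact: rannulMr.
  move=> /(EP_rprincipal R A a ha) ax; exists 1, a, 1, (mpinv a), 1.
  by split; rewrite ?mul1r ?mulr1 ?rprincipal1.
- move=> [h [k [l [m [n [aE xE l1 n1 km]]]]]].
  have /(EP_rprincipal R A a ha) : rprincipal a = rprincipal (mpinv a).
    by rewrite xE aE (rprincipalMr _ _ l)// (rprincipalMr _ _ n)//; exact: rprincipalMl.
  move=> /(EP_lannul R A a ha) ax; exists 1, a, (mpinv a), 1, 1.
  by split; rewrite ?mul1r ?mulr1 ?lannul1.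
- move=> [b [c [d [g [g' [aE xE cd g0 g0']]]]]].
  have /(EP_lannul R A a ha) : lannul a = lannul (mpinv a).
    by rewrite xE aE (lannulMr _ g)// (lannulMr _ g')//; exact: lannulMl.
  move=> /(EP_lprincipal R A a ha) ax; exists 1, 1, a, 1, (mpinv a).
  by split; rewrite ?mul1r ?mulr1 ?lprincipal1.
- move=> [h [h' [k [l [m [aE xE km h1 h1']]]]]].
  apply/(EP_lprincipal R A a ha).
  by rewrite xE aE -!mulrA (lprincipalMl _ _ h)// (lprincipalMl _ _ h')//;
    exact: lprincipalMr.
Qed.
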